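(* Let $A\in\mathbb{R}^{m\times n}$ and $0\neq b\in\mathbb{R}^m$, and consider the first $k\ge 1$ steps of the Golub-Kahan iterative bidiagonalization of $A$ started with $b$, where it is assumed that the process does not terminate before iteration $k+1$, i.e. $\alpha_l>0$ and $\beta_{l+1}>0$ for $l=1,\dots,k$. Let $x_k^{\text{CRAIG}}=W_k y_k^{\text{CRAIG}}$, where $y_k^{\text{CRAIG}}\in\mathbb{R}^k$ is the solution of $L_k y_k^{\text{CRAIG}}=\beta_1 e_1$. Then $x_k^{\text{CRAIG}}$ is an exact solution of the consistent problem $$Ax = b-\varphi_k(0)^{-1}s_{k+1}.$$ Consequently, the residual $r_k^{\text{CRAIG}}=b-Ax_k^{\text{CRAIG}}$ satisfies $$\|r_k^{\text{CRAIG}}\| = |\varphi_k(0)|^{-1}.$$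
   Context: Exact arithmetic is assumed. $\|\cdot\|$ is the Euclidean norm and $e_j$ is the $j$-th column of an identity matrix of appropriate size. Golub-Kahan iterative bidiagonalization: put $w_0=0$, $\beta_1=\|b\|$, $s_1=b/\beta_1$, and for $j=1,2,\dots$ $$\alpha_j w_j = A^Ts_j-\beta_j w_{j-1},\quad \|w_j\|=1,\qquad \beta_{j+1}s_{j+1}=Aw_j-\alpha_j s_j,\quad \|s_{j+1}\|=1,$$ with $\alpha_j,\beta_{j+1}\ge 0$; the process stops when $\alpha_j=0$ or $\beta_{j+1}=0$, or $j=\min(m,n)$. The vectors $s_1,s_2,\dots$ are orthonormal, as are $w_1,w_2,\dots$. $W_k=[w_1,\dots,w_k]\in\mathbb{R}^{n\times k}$, and $L_k\in\mathbb{R}^{k\times k}$ is the lower bidiagonal matrix with diagonal entries $\alpha_1,\dots,\alpha_k$ and subdiagonal entries $\beta_2,\dots,\beta_k$ (so $(L_k)_{j,j}=\alpha_j$, $(L_k)_{j+1,j}=\beta_{j+1}$). $\varphi_k$ denotes the (Lanczos) polynomial of degree at most $k$ such that $s_{k+1}=\varphi_k(AA^T)b$; its constant term (the amplification factor) is $$\varphi_k(0)=(-1)^k\frac{1}{\beta_{k+1}}\prod_{j=1}^k\frac{\alpha_j}{\beta_j}.$$ *)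

(* Defs.v *)
From mathcomp Require Import all_boot all_order all_algebra.

Set Implicit Arguments.
Unset Strict Implicit.
Unset Printing Implicit Defensive.

Import Order.TTheory GRing.Theory Num.Theory.
Local Open Scope ring_scope.

Definition norm2 (R : rcfType) (n : nat) (v : 'cV[R]_n) : R :=
  Num.sqrt (\sum_(i < n) v i 0 ^+ 2).

(* The sequences are numbered from 1 as in the usual presentation: only
   [s 1 .. s k.+1], [w 0 .. w k], [alpha 1 .. alpha k] and
   [beta 1 .. beta k.+1] are constrained, other values being irrelevant.
   Positivity of the coefficients, i.e. absence of breakdown, is not included
   and has to be assumed separately. *)
Definition golub_kahan (R : rcfType) (m n : nat) (A : 'M[R]_(m, n))
    (b : 'cV[R]_m) (k : nat) (s : nat -> 'cV[R]_m) (w : nat -> 'cV[R]_n)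
    (alpha beta : nat -> R) : Prop :=
  [/\ w 0%N = 0, beta 1%N = norm2 b, s 1%N = (beta 1%N)^-1 *: b
    & forall j : nat, (1 <= j <= k)%N ->
      [/\ alpha j *: w j = A^T *m s j - beta j *: w j.-1,
          norm2 (w j) = 1 /\ 0 <= alpha j,
          beta j.+1 *: s j.+1 = A *m w j - alpha j *: s j
        & norm2 (s j.+1) = 1 /\ 0 <= beta j.+1]].

(* Matrix indices start at 0, those of [w], [alpha] and [beta] at 1. *)
Definition gk_W (R : rcfType) (n k : nat) (w : nat -> 'cV[R]_n) :
    'M[R]_(n, k) :=
  \matrix_(i < n, j < k) w j.+1 i 0.

Definition gk_L (R : rcfType) (k : nat) (alpha beta : nat -> R) : 'M[R]_k :=
  \matrix_(i < k, j < k)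
    if i == j :> nat then alpha j.+1
    else if i == j.+1 :> nat then beta i.+1
    else 0.

Definition e1 (R : rcfType) (k : nat) : 'cV[R]_k :=
  \col_(i < k) (i == 0 :> nat)%:R.

(* [size phi <= k.+1] says that phi has degree at most k.  The row dimension is
   a successor because square matrices form a (nontrivial) ring only then. *)
Definition lanczos_poly (R : rcfType) (m n : nat) (A : 'M[R]_(m.+1, n))
    (b : 'cV[R]_m.+1) (k : nat) (s : nat -> 'cV[R]_m.+1) (phi : {poly R}) :
    Prop :=
  (size phi <= k.+1)%N /\ s k.+1 = horner_mx (A *m A^T) phi *m b.

Lemma lanczos_poly_exists (R : rcfType) (m n : nat) (A : 'M[R]_(m.+1, n))
    (b : 'cV[R]_m.+1) (k : nat) (s : nat -> 'cV[R]_m.+1) (w : nat -> 'cV[R]_n)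
    (alpha beta : nat -> R) :
  golub_kahan A b k s w alpha beta ->
  (forall l : nat, (1 <= l <= k)%N -> 0 < alpha l /\ 0 < beta l.+1) ->
  exists phi : {poly R}, lanczos_poly A b k s phi.
Proof.
move=> [w0 _ s1 rec] pos; rewrite /lanczos_poly; set M := A *m A^T.
have hZ c (p : {poly R}) : horner_mx M (c *: p) = c *: horner_mx M p.
  exact: linearZ.
have hB (p q : {poly R}) : horner_mx M (p - q) = horner_mx M p - horner_mx M q.
  exact: rmorphB.
have hXM (p : {poly R}) : horner_mx M ('X * p) = M *m horner_mx M p.
  by rewrite (rmorphM (horner_mx M)) /= horner_mx_X mulmxE.
suff H j : (j <= k)%N -> exists p q : {poly R},
    [/\ (size p <= j.+1)%N, (size q <= j)%N, s j.+1 = horner_mx M p *m b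
      & w j = A^T *m (horner_mx M q *m b)].
  by have [p [q [sp _ Hp _]]] := H k (leqnn k); exists p.
elim: j => [_|j IH ltjk].
  exists (beta 1%N)^-1%:P, 0; rewrite size_polyC size_poly0 leq_b1; split=> //.
    by rewrite s1 horner_mx_C mul_scalar_mx.
  by rewrite w0 rmorph0 mul0mx mulmx0.
have [p [q [sp sq Hp Hq]]] := IH (ltnW ltjk).
have jk : (1 <= j.+1 <= k)%N by [].
have [Ew _ Es _] := rec _ jk; have [a0 b0] := pos _ jk.
pose q' := (alpha j.+1)^-1 *: (p - beta j.+1 *: q).
have sq' : (size q' <= j.+1)%N.
  rewrite (leq_trans (size_scale_leq _ _)) // (leq_trans (size_polyD _ _)) //.
  rewrite geq_max sp size_polyN (leq_trans (size_scale_leq _ _)) //.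
  exact: leqW.
have Hw : w j.+1 = A^T *m (horner_mx M q' *m b).
  rewrite -[LHS]scale1r -(mulVf (lt0r_neq0 a0)) -scalerA Ew /= Hp Hq.
  rewrite /q' hZ hB hZ -!scalemxAl -scalemxAr.
  by rewrite mulmxBl mulmxBr -scalemxAl -scalemxAr.
clearbody q'; pose p' := (beta j.+2)^-1 *: ('X * q' - alpha j.+1 *: p).
exists p', q'; rewrite {}/p'; split=> //.
  rewrite (leq_trans (size_scale_leq _ _)) // (leq_trans (size_polyD _ _)) //.
  rewrite geq_max size_polyN (leq_trans (size_polyMleq _ _)) ?size_polyX //=.
  by rewrite (leq_trans (size_scale_leq _ _)) // leqW.
rewrite -[LHS]scale1r -(mulVf (lt0r_neq0 b0)) -scalerA Es Hw Hp.
rewrite hZ hB hXM hZ -!scalemxAl.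
by rewrite mulmxBl -scalemxAl -!mulmxA.
Qed.

Lemma gk_L_unit (R : rcfType) (k : nat) (alpha beta : nat -> R) :
  (forall l : nat, (1 <= l <= k)%N -> 0 < alpha l) ->
  gk_L k alpha beta \in unitmx.
Proof.
move=> pos; rewrite unitmxE unitfE det_trig.
  by apply/prodf_neq0 => i _; rewrite mxE eqxx lt0r_neq0 // pos /=.
apply/is_trig_mxP => i j lt_ij; rewrite mxE (ltn_eqF lt_ij).
by rewrite (ltn_eqF (leqW lt_ij)).
Qed.

(* Main.v *)
Require Import Defs.
From mathcomp Require Import all_boot all_order all_algebra.

(** Write [M] for [A *m A^T].  The proof compares two polynomial expressions
    of the CRAIG residual [r = b - A *m x] in [M] applied to [b].

    On one side, the recurrences say that
    [A W_k = S_k L_k + beta_(k+1) s_(k+1) e_k^T] with [S_k = (s_1, ..., s_k)].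
    Applied to [y], where [L_k y = beta_1 e_1], this makes [A *m x] equal to
    [b] up to a multiple of [s_(k+1)]: [r = rho *: s_(k+1)] for some scalar
    [rho], that is [r = (rho *: phi)(M) b] ([craig_residual]).

    On the other side, [x] lies in the span of the [w_j], hence
    [x = A^T q(M) b] with [q] of degree less than [k] ([gk_W_krylov]), so that
    [r = (1 - 'X * q)(M) b].

    Both polynomials have degree at most [k], and on such polynomials [p] the
    map sending [p] to [p(M) b] is injective ([horner_krylov_eq0]), because the
    [k + 1] vectors [s_1, ..., s_(k+1)] of its image are orthonormal
    ([gk_s_orthonormal]).  Therefore [rho *: phi = 1 - 'X * q], and evaluating
    at [0] gives [rho * phi.[0] = 1].  The norm of the residual follows as
    [s_(k+1)] is a unit vector. *)

Import Order.TTheory GRing.Theory Num.Theory.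
Local Open Scope ring_scope.

(** * The Euclidean inner product *)

Definition dot {R : rcfType} {n : nat} (u v : 'cV[R]_n) : R := (u^T *m v) 0 0.

Section Dot.
Context {R : rcfType}.

Lemma dotC n (u v : 'cV[R]_n) : dot u v = dot v u.
Proof. by rewrite /dot !mxE; apply: eq_bigr => i _; rewrite !mxE mulrC. Qed.

Lemma dotDr n (u v1 v2 : 'cV[R]_n) : dot u (v1 + v2) = dot u v1 + dot u v2.
Proof. by rewrite /dot mulmxDr mxE. Qed.

Lemma dotZr n c (u v : 'cV[R]_n) : dot u (c *: v) = c * dot u v.
Proof. by rewrite /dot -scalemxAr mxE. Qed.

Lemma dot0r n (u : 'cV[R]_n) : dot u 0 = 0.
Proof. by rewrite /dot mulmx0 mxE. Qed.

Lemma dot_adjoint m n (A : 'M[R]_(m, n)) u v :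
  dot u (A *m v) = dot v (A^T *m u).
Proof. by rewrite dotC /dot trmx_mul -mulmxA. Qed.

Lemma norm2E n (v : 'cV[R]_n) : norm2 v = Num.sqrt (dot v v).
Proof. by rewrite /norm2 /dot mxE; under [in RHS]eq_bigr do rewrite mxE. Qed.

Lemma dot_ge0 n (v : 'cV[R]_n) : 0 <= dot v v.
Proof. by rewrite /dot mxE sumr_ge0 // => i _; rewrite mxE sqr_ge0. Qed.

Lemma norm2_eq1 n (v : 'cV[R]_n) : norm2 v = 1 -> dot v v = 1.
Proof. by move=> v1; rewrite -(sqr_sqrtr (dot_ge0 n v)) -norm2E v1 expr1n. Qed.

Lemma norm2Z n c (v : 'cV[R]_n) : norm2 (c *: v) = `|c| * norm2 v.
Proof.
by rewrite !norm2E dotZr dotC dotZr mulrA -expr2 sqrtrM ?sqr_ge0 // sqrtr_sqr.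
Qed.

Lemma norm2_gt0 n (v : 'cV[R]_n) : v != 0 -> 0 < norm2 v.
Proof.
move=> v_neq0; rewrite norm2E sqrtr_gt0 lt0r dot_ge0 andbT.
apply: contra_neq v_neq0 => /eqP; rewrite /dot mxE psumr_eq0 => [/allP v0|i _].
  apply/colP => i; have /(_ (mem_index_enum i)) := v0 i.
  by rewrite !mxE mulf_eq0 orbb => /eqP.
by rewrite mxE sqr_ge0.
Qed.

Lemma norm2_normalize n (v : 'cV[R]_n) :
  v != 0 -> norm2 ((norm2 v)^-1 *: v) = 1.
Proof.
move=> /norm2_gt0 v_gt0.
by rewrite norm2Z ger0_norm ?invr_ge0 ?ltW // mulVf ?gt_eqF.
Qed.

End Dot.

(** * Krylov subspaces *)

Lemma mulmx_sum_col {R : comNzRingType} m n (A : 'M[R]_(m, n)) (v : 'cV[R]_n) :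
  A *m v = \sum_i v i 0 *: col i A.
Proof.
apply/colP => r; rewrite mxE summxE.
by apply: eq_bigr => i _; rewrite !mxE mulrC.
Qed.

Lemma col_matrix {R : Type} m n (f : 'I_n -> 'cV[R]_m) i :
  col i (\matrix_(r, j) f j r ord0) = f i.
Proof. by apply/colP => r; rewrite !mxE. Qed.

Lemma horner_mx_coef {R : rcfType} m (M : 'M[R]_m.+1) (b : 'cV[R]_m.+1)
    k (d : {poly R}) : (size d <= k)%N ->
  horner_mx M d *m b = \sum_(i < k) d`_i *: (M ^+ i *m b).
Proof.
move=> size_d.
have {1}-> : d = \sum_(i < k) d`_i *: 'X^i.
  rewrite -poly_def; apply/polyP => i; rewrite coef_poly.
  by case: ltnP => // /(leq_trans size_d)/leq_sizeP ->.
rewrite (raddf_sum (horner_mx M)) mulmx_suml; apply: eq_bigr => i _ /=.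
by rewrite linearZ /= rmorphXn /= horner_mx_X -scalemxAl.
Qed.

(** Polynomials of size at most [k] form a space of dimension [k], so a map
    [p |-> p(M) b] on it whose image contains [k] independent vectors has no
    kernel.  In matrix form: the Krylov matrix [K] satisfies [K *m P = S] with
    [S] having orthonormal columns and [P] square; from [S^T *m K *m P = 1]
    follows [P *m S^T *m K = 1], a left inverse for [K]. *)
Lemma horner_krylov_eq0 {R : rcfType} m (M : 'M[R]_m.+1) (b : 'cV[R]_m.+1) k
    (t : 'I_k -> 'cV[R]_m.+1) (d : {poly R}) :
  (forall i j, dot (t i) (t j) = (i == j)%:R) ->
  (forall i, exists2 p : {poly R},
    (size p <= k)%N & t i = horner_mx M p *m b) ->
  (size d <= k)%N -> horner_mx M d *m b = 0 -> d = 0.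
Proof.
move=> t_on t_krylov size_d d_b.
pose K := \matrix_(r < m.+1, i < k) (M ^+ i *m b) r 0.
have KE (p : {poly R}) : (size p <= k)%N ->
    horner_mx M p *m b = K *m \col_(i < k) p`_i.
  move=> size_p; rewrite (horner_mx_coef _ _ _ k) // [in RHS]mulmx_sum_col.
  by apply: eq_bigr => i _; rewrite mxE col_matrix.
have /fin_all_exists[p pP] : forall i, exists p : {poly R},
    (size p <= k)%N /\ t i = horner_mx M p *m b.
  by move=> i; have [p size_p tE] := t_krylov i; exists p.
pose S := \matrix_(r < m.+1, i < k) t i r 0.
pose P := \matrix_(l < k, i < k) (p i)`_l.
have SE : S = K *m P.
  apply/matrixP => r i; have [size_pi tE] := pP i.
  rewrite mxE tE KE // !mxE.
  by apply: eq_bigr => l _; rewrite !mxE.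
have StS : S^T *m S = 1%:M.
  apply/matrixP => i j; rewrite mxE [RHS]mxE -t_on /dot mxE.
  by apply: eq_bigr => r _; rewrite !mxE.
have PSK : P *m (S^T *m K) = 1%:M by apply: mulmx1C; rewrite -mulmxA -SE.
have d0 : \col_(i < k) d`_i = 0.
  by rewrite -[LHS]mul1mx -PSK -!mulmxA -KE // d_b !mulmx0.
apply/polyP => i; rewrite coef0; have [lt_ik|le_ki] := ltnP i k.
  by have /colP/(_ (Ordinal lt_ik)) := d0; rewrite !mxE.
by rewrite nth_default // (leq_trans size_d).
Qed.

(** * Golub-Kahan bidiagonalization *)

Section GolubKahan.
Context {R : rcfType} {m n k : nat}.
Context {A : 'M[R]_(m.+1, n)} {b : 'cV[R]_m.+1}.
Context {s : nat -> 'cV[R]_m.+1} {w : nat -> 'cV[R]_n} {alpha beta : nat -> R}.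
Hypothesis gk : golub_kahan A b k s w alpha beta.

Lemma gk_mulA j : (1 <= j <= k)%N ->
  A *m w j = alpha j *: s j + beta j.+1 *: s j.+1.
Proof. by case: gk => _ _ _ rec /rec[_ _ -> _]; rewrite addrC subrK. Qed.

Lemma gk_mulAT j : (1 <= j <= k)%N ->
  A^T *m s j = alpha j *: w j + beta j *: w j.-1.
Proof. by case: gk => _ _ _ rec /rec[-> _ _ _]; rewrite subrK. Qed.

Lemma gk_prefix j : (j <= k)%N -> golub_kahan A b j s w alpha beta.
Proof.
case: gk => w0 b1 s1 rec le_jk; split=> // i /andP[i1 le_ij].
by apply: rec; rewrite i1 (leq_trans le_ij).
Qed.

Lemma gk_mulAW :
  A *m gk_W k w = gk_W k s *m gk_L k alpha beta
    + beta k.+1 *: (s k.+1 *m (\row_(j < k) (j.+1 == k)%:R)).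
Proof.
apply/matrixP => r j.
have -> : (A *m gk_W k w) r j = (A *m w j.+1) r 0.
  by rewrite !mxE; apply: eq_bigr => i _; rewrite mxE.
rewrite gk_mulA ?ltn_ord // !mxE big_ord1 mxE.
under [in RHS]eq_bigr do rewrite !mxE.
rewrite (bigD1 j) //= eqxx mulrC -addrA; congr (_ + _).
rewrite (eq_bigr (fun i : 'I_k =>
  s i.+1 r 0 * (if i == j.+1 :> nat then beta i.+1 else 0))); last first.
  by move=> i /negPf ne_ij; rewrite (ne_ij : (i == j :> nat) = false).
(* Column [j] of [L] has a subdiagonal entry except when it is the last one;
   the last column is where the rank-one term is nonzero. *)
have [lt_jk|le_kj] := ltnP j.+1 k.
  rewrite (bigD1 (Ordinal lt_jk)) /=; last by rewrite -val_eqE /= gtn_eqF.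
  rewrite eqxx mulrC big1 ?addr0 => [|i /andP[_]].
    by rewrite ltn_eqF // !mulr0 addr0.
  by rewrite -val_eqE /= => /negPf ->; rewrite mulr0.
have jk : j.+1 = k by apply/eqP; rewrite eqn_leq ltn_ord.
rewrite jk eqxx mulr1 big1 ?add0r // => i _.
by rewrite ltn_eqF ?mulr0 // jk.
Qed.

(** The right-hand side [beta_1 e_1] is mapped by [S_k] to [beta_1 s_1 = b], so
    only the rank-one term of [gk_mulAW] survives in the residual. *)
Lemma craig_residual (k_gt0 : (0 < k)%N) (b_neq0 : b != 0) (y : 'cV[R]_k) :
    gk_L k alpha beta *m y = beta 1%N *: e1 R k ->
  exists rho, b - A *m (gk_W k w *m y) = rho *: s k.+1.
Proof.
move=> Ly; case: gk => _ b1 s1 _.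
pose c := (\row_(j < k) (j.+1 == k)%:R *m y) 0 0.
exists (- (beta k.+1 * c)).
rewrite mulmxA gk_mulAW // mulmxDl -mulmxA Ly -scalemxAr.
have -> : gk_W k s *m e1 R k = s 1%N.
  apply/colP => r; rewrite mxE (bigD1 (Ordinal k_gt0)) //= !mxE mulr1.
  rewrite big1 ?addr0 // => i; rewrite !mxE -val_eqE /= => /negPf ->.
  by rewrite mulr0.
rewrite s1 scalerA divff ?b1 ?gt_eqF ?norm2_gt0 // scale1r.
rewrite -scalemxAl -mulmxA [X in s _ *m X]mx11_scalar mul_mx_scalar.
by rewrite scalerA opprD addNKr scaleNr.
Qed.

Hypothesis pos :
  forall l : nat, (1 <= l <= k)%N -> 0 < alpha l /\ 0 < beta l.+1.

Lemma gk_s_krylov j : (j <= k)%N ->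
  exists2 p : {poly R}, (size p <= j.+1)%N &
    s j.+1 = horner_mx (A *m A^T) p *m b.
Proof.
move=> le_jk; have pos_j l : (1 <= l <= j)%N -> 0 < alpha l /\ 0 < beta l.+1.
  by case/andP=> l1 le_lj; apply: pos; rewrite l1 (leq_trans le_lj).
by have [p []] := lanczos_poly_exists (gk_prefix _ le_jk) pos_j; exists p.
Qed.

(** The bound on the size of [q] is one less than the one for [s j.+1]: after
    the outer factor [A^T], another application of [A] raises the degree by
    one and still stays within degree [j]. *)
Lemma gk_w_krylov j : (j <= k)%N ->
  exists2 q : {poly R}, (size q <= j)%N &
    w j = A^T *m (horner_mx (A *m A^T) q *m b).
Proof.
elim: j => [|j IH] lt_jk.
  by exists 0; rewrite ?size_poly0 // rmorph0 mul0mx mulmx0; case: gk.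
have [q size_q wE] := IH (ltnW lt_jk).
have [p size_p sE] := gk_s_krylov _ (ltnW lt_jk).
have jk : (1 <= j.+1 <= k)%N by [].
have [a_gt0 _] := pos _ jk.
exists ((alpha j.+1)^-1 *: (p - beta j.+1 *: q)).
  rewrite (leq_trans (size_scale_leq _ _)) // (leq_trans (size_polyD _ _)) //.
  rewrite geq_max size_p size_polyN (leq_trans (size_scale_leq _ _)) //.
  exact: leqW.
apply: (scalerI (lt0r_neq0 a_gt0)).
rewrite linearZ /= -scalemxAl -scalemxAr scalerA divff ?lt0r_neq0 // scale1r.
rewrite raddfB /= linearZ /= mulmxBl mulmxBr -sE -scalemxAl -scalemxAr -wE.
by rewrite gk_mulAT // addrK.
Qed.

Lemma gk_W_krylov (y : 'cV[R]_k) :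
  exists2 q : {poly R}, (size q <= k)%N &
    gk_W k w *m y = A^T *m (horner_mx (A *m A^T) q *m b).
Proof.
have /fin_all_exists[q qP] : forall i : 'I_k, exists q : {poly R},
    (size q <= k)%N /\ w i.+1 = A^T *m (horner_mx (A *m A^T) q *m b).
  move=> i; have [q size_q wE] := gk_w_krylov i.+1 (ltn_ord i).
  by exists q; rewrite (leq_trans size_q).
exists (\sum_i y i 0 *: q i).
  apply: (leq_trans (size_sum _ _ _)); apply/bigmax_leqP => i _.
  by rewrite (leq_trans (size_scale_leq _ _)) //; case: (qP i).
rewrite mulmx_sum_col (raddf_sum (horner_mx _)) mulmx_suml mulmx_sumr.
apply: eq_bigr => i _ /=; have [_ wE] := qP i.
by rewrite linearZ /= -scalemxAl -scalemxAr -wE col_matrix.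
Qed.

Hypothesis b_neq0 : b != 0.

Lemma gk_s_unit j : (j <= k)%N -> dot (s j.+1) (s j.+1) = 1.
Proof.
case: gk => _ b1 s1 rec; case: j => [_|j lt_jk]; apply: norm2_eq1.
  by rewrite s1 b1 norm2_normalize.
by have [|_ _ _ []] := rec j.+1.
Qed.

Lemma gk_w_unit j : (1 <= j <= k)%N -> dot (w j) (w j) = 1.
Proof. by case: gk => _ _ _ rec /rec[_ [/norm2_eq1]]. Qed.

(** Each new vector is orthogonalized explicitly only against its predecessor.
    Orthogonality to the older ones is inherited from the other sequence:
    up to products already known, [s_(j+2)] against [s_i] reduces by
    adjunction to [w_(j+1)] against [w_i] and [w_(i-1)], and [w_(j+1)] against
    [w_i] to [s_(j+1)] against [s_i] and [s_(i+1)].  Hence both sequences go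
    in one induction. *)
Lemma gk_orthogonal j : (j <= k)%N ->
  (forall i, (i < j)%N -> dot (s j.+1) (s i.+1) = 0) /\
  (forall i, (i < j)%N -> dot (w j) (w i) = 0).
Proof.
have w0 : w 0%N = 0 by case: gk.
elim: j => [//|j IH] lt_jk.
have [sj wj] := IH (ltnW lt_jk).
have jk : (1 <= j.+1 <= k)%N by [].
have [a_gt0 b_gt0] := pos _ jk.
have wSj i : (i < j.+1)%N -> dot (w j.+1) (w i) = 0.
  case: i => [|i]; first by rewrite w0 dot0r.
  move=> lt_ij; apply: (mulfI (lt0r_neq0 a_gt0)); rewrite mulr0.
  have := gk_mulAT _ jk.
  move/(congr1 (dot (w i.+1))); rewrite -dot_adjoint dotDr !dotZr.
  have ik : (1 <= i.+1 <= k)%N by exact: ltnW (leq_trans lt_ij lt_jk).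
  rewrite gk_mulA // dotDr !dotZr (sj i) // mulr0 add0r.
  (* For [i.+1 = j] both sides carry the same term [beta j.+1], which cancels;
     for smaller indices everything else vanishes. *)
  move: lt_ij; rewrite ltnS [dot _ (w j.+1)]dotC [dot _ (w j)]dotC /=.
  rewrite leq_eqVlt => /predU1P[<-|lt_ij].
    rewrite gk_s_unit // gk_w_unit //.
    by rewrite -[LHS]add0r => /addIr.
  by rewrite sj // wj // !mulr0 addr0.
split=> // i; rewrite ltnS => le_ij; apply: (mulfI (lt0r_neq0 b_gt0)).
have := gk_mulA _ jk.
move/(congr1 (dot (s i.+1))); rewrite dot_adjoint dotDr !dotZr.
have ik : (1 <= i.+1 <= k)%N by rewrite (leq_ltn_trans le_ij).
rewrite gk_mulAT // dotDr !dotZr /= (wSj i) // mulr0 addr0 mulr0.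
rewrite [dot _ (s j.+2)]dotC [dot _ (s j.+1)]dotC.
move: le_ij; rewrite leq_eqVlt => /predU1P[<-|lt_ij].
  by rewrite gk_s_unit 1?ltnW // gk_w_unit // -[LHS]addr0 => /addrI.
by rewrite sj // wSj // !mulr0 add0r.
Qed.

Lemma gk_s_orthonormal i j : (i <= k)%N -> (j <= k)%N ->
  dot (s i.+1) (s j.+1) = (i == j)%:R.
Proof.
move=> le_ik le_jk; have [lt_ij|lt_ji|->] := ltngtP i j.
- by rewrite dotC; have [->] := gk_orthogonal _ le_jk.
- by have [->] := gk_orthogonal _ le_ik.
- exact: gk_s_unit.
Qed.

End GolubKahan.

Theorem proposition1 (R : rcfType) (m n : nat) (A : 'M[R]_(m.+1, n))
    (b : 'cV[R]_m.+1) (b_neq0 : b != 0) (k : nat) (k_ge1 : (1 <= k)%N)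
    (s : nat -> 'cV[R]_m.+1) (w : nat -> 'cV[R]_n) (alpha beta : nat -> R)
    (gk : golub_kahan A b k s w alpha beta)
    (no_breakdown :
      forall l : nat, (1 <= l <= k)%N -> 0 < alpha l /\ 0 < beta l.+1)
    (phi : {poly R}) (phi_lanczos : lanczos_poly A b k s phi)
    (y : 'cV[R]_k) (y_craig : gk_L k alpha beta *m y = beta 1%N *: e1 R k)
    (x : 'cV[R]_n) (x_craig : x = gk_W k w *m y) :
  [/\ phi.[0] != 0,
      A *m x = b - (phi.[0])^-1 *: s k.+1
    & norm2 (b - A *m x) = `|phi.[0]|^-1].
Proof.
have [size_phi phiE] := phi_lanczos.
have [rho] := craig_residual gk k_ge1 b_neq0 y y_craig.
rewrite -x_craig => res.
set M := A *m A^T in phiE.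
have [q size_q] := gk_W_krylov gk no_breakdown y.
rewrite -x_craig => xE.
have rho_phi : rho *: phi - (1 - 'X * q) = 0.
  apply: (horner_krylov_eq0 m M b k.+1 (fun i => s i.+1)).
  - move=> i j.
    by rewrite (gk_s_orthonormal gk no_breakdown b_neq0) // -ltnS ltn_ord.
  - move=> i; have [p size_p sE] := gk_s_krylov gk no_breakdown i (ltn_ord i).
    by exists p; rewrite ?(leq_trans size_p).
  - rewrite (leq_trans (size_polyD _ _)) // geq_max size_polyN.
    rewrite (leq_trans (size_scale_leq _ _)) //=.
    rewrite (leq_trans (size_polyD _ _)) // geq_max size_polyN size_poly1 /=.
    by rewrite (leq_trans (size_polyMleq _ _)) // size_polyX.
  - rewrite 2!rmorphB /= linearZ /= rmorph1 rmorphM /= horner_mx_X -mulmxE.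
    rewrite mulmxBl -scalemxAl -phiE mulmxBl -res xE !mulmxA mul1mx.
    by rewrite subrr.
have rho1 : rho * phi.[0] = 1.
  have /(congr1 (horner^~ 0))/eqP := rho_phi.
  by rewrite !hornerE subr0 subr_eq0 => /eqP.
have phi0 : phi.[0] != 0.
  by apply: contra_eq_neq rho1 => ->; rewrite mulr0 eq_sym oner_neq0.
have rhoE : rho = phi.[0]^-1 by rewrite -[LHS](mulfK phi0) rho1 mul1r.
split=> //; first by rewrite -rhoE -res subKr.
rewrite res rhoE norm2Z normfV; case: gk => _ _ _ rec.
by have [|_ _ _ [-> _]] := rec k; rewrite ?k_ge1 ?leqnn ?mulr1.
Qed.
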